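(* Let $K$ be a field with algebraic closure $\overline{K}$, let $f\in K(x)$ be nonzero, and let $d$ be the greatest proper divisor of $\deg f$ (the largest positive divisor of $\deg f$ smaller than $\deg f$). If $\operatorname{ord}_\infty f\neq 0$ and $\operatorname{ord}_\infty f$ is divisible by a prime $p>d$, then $f$ is prime over $\overline{K}$.
   Context: For $u\in K(x)\setminus\{0\}$ written as $u=u_1/u_2$ with $u_1,u_2\in K[x]$ coprime, $\deg u=\max\{\deg u_1,\deg u_2\}$ and $\operatorname{ord}_\infty u=\deg u_2-\deg u_1$. For a field extension $L/K$, $f\in K(x)$ is composite over $L$ if $f=g\circ h$ with $g,h\in L(x)$, $\deg g\ge 2$, $\deg h\ge 2$; otherwise $f$ is prime over $L$. *)

(* Defs.v *)
From HB Require Import structures.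
From mathcomp Require Import all_boot all_order all_algebra.

Set Implicit Arguments.
Unset Strict Implicit.
Unset Printing Implicit Defensive.

Import GRing.Theory.
Local Open Scope ring_scope.

Notation "x %:F" := (@FracField.tofrac _ x) : ring_scope.

(* K(x) is {fraction {poly K}}. The library's representative [repr u] of a
   fraction need not be in lowest terms, hence the division by the gcd. The
   coprime pair so obtained is determined up to a common unit only; the notions
   below do not depend on that unit (see [ratdeg_frac] and [ord_inf_frac]). *)
Definition ratnum (K : fieldType) (u : {fraction {poly K}}) : {poly K} :=
  \n_(repr u) %/ gcdp \n_(repr u) \d_(repr u).

Definition ratden (K : fieldType) (u : {fraction {poly K}}) : {poly K} :=
  \d_(repr u) %/ gcdp \n_(repr u) \d_(repr u).

Definition ratdeg (K : fieldType) (u : {fraction {poly K}}) : nat :=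
  maxn (size (ratnum u)).-1 (size (ratden u)).-1.

(* Meaningful for u != 0. *)
Definition ord_inf (K : fieldType) (u : {fraction {poly K}}) : int :=
  (size (ratden u)).-1%:Z - (size (ratnum u)).-1%:Z.

(* The embedding K(x) -> L(x) induced by an embedding K -> L. *)
Definition map_rat (K L : fieldType) (iota : {rmorphism K -> L})
    (u : {fraction {poly K}}) : {fraction {poly L}} :=
  (map_poly iota (ratnum u))%:F / (map_poly iota (ratden u))%:F.

(* g(h(x)); when h is not constant it is transcendental over L, so that the
   denominator below does not vanish. *)
Definition comp_rat (L : fieldType) (g h : {fraction {poly L}}) :
    {fraction {poly L}} :=
  let cst := fun c : L => c%:P%:F in
  (map_poly cst (ratnum g)).[h] / (map_poly cst (ratden g)).[h].

Definition composite_over (K L : fieldType) (iota : {rmorphism K -> L})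
    (f : {fraction {poly K}}) : Prop :=
  exists g h : {fraction {poly L}},
    [/\ (2 <= ratdeg g)%N, (2 <= ratdeg h)%N & map_rat iota f = comp_rat g h].

Definition prime_over (K L : fieldType) (iota : {rmorphism K -> L})
    (f : {fraction {poly K}}) : Prop :=
  ~ composite_over iota f.

Definition algebraic_closure (K : fieldType) (L : closedFieldType)
    (iota : {rmorphism K -> L}) : Prop :=
  forall z : L, algebraicOver iota z.

Definition greatest_proper_divisor (d n : nat) : Prop :=
  [/\ (0 < d)%N, (d %| n)%N, (d < n)%N &
      forall e : nat, (0 < e)%N -> (e %| n)%N -> (e < n)%N -> (e <= d)%N].

Lemma ratden_neq0 (K : fieldType) (u : {fraction {poly K}}) : ratden u != 0.
Proof.
have d0 := denom_ratioP (repr u).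
by rewrite /ratden dvdp_div_eq0 ?dvdp_gcdr.
Qed.

Lemma coprimep_ratnum_ratden (K : fieldType) (u : {fraction {poly K}}) :
  coprimep (ratnum u) (ratden u).
Proof. by apply: coprimep_div_gcd; rewrite denom_ratioP orbT. Qed.

Lemma frac_repr (K : fieldType) (u : {fraction {poly K}}) :
  u = (\n_(repr u))%:F / (\d_(repr u))%:F.
Proof.
have d0 := denom_ratioP (repr u).
apply: (canRL (mulfK _)); first by rewrite tofrac_eq0.
move: (repr u) d0 (reprK u) => r d0 <-.
rewrite !piE; apply/eqP; rewrite piE /= FracField.equivfE /FracField.mulf.
by rewrite !numden_Ratio ?mulf_neq0 ?oner_eq0 // !mulr1 mulrC.
Qed.

Lemma ratnumE (K : fieldType) (u : {fraction {poly K}}) :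
  u = (ratnum u)%:F / (ratden u)%:F.
Proof.
have d0 := denom_ratioP (repr u).
rewrite [LHS]frac_repr.
apply/eqP; rewrite eqr_div ?tofrac_eq0 ?ratden_neq0 //.
rewrite -!tofracM tofrac_eq /ratnum /ratden.
by rewrite divp_mulA ?dvdp_gcdr // divp_mulAC ?dvdp_gcdl.
Qed.

Lemma size_ratnum_ratden (K : fieldType) (a b : {poly K}) :
  b != 0 -> coprimep a b ->
  size (ratnum (a%:F / b%:F)) = size a /\ size (ratden (a%:F / b%:F)) = size b.
Proof.
move=> b0 cab; set u := a%:F / b%:F.
have /eqP := ratnumE u.
rewrite {1}/u eqr_div ?tofrac_eq0 ?ratden_neq0 // -!tofracM tofrac_eq => /eqP e.
have c := coprimep_ratnum_ratden u.
split; apply/eqp_size; rewrite /eqp; apply/andP; split.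
- by rewrite -(Gauss_dvdpl _ c) e dvdp_mulr.
- by rewrite -(Gauss_dvdpl _ cab) -e dvdp_mulr.
- by rewrite -(Gauss_dvdpr b (etrans (coprimep_sym _ _) c)) -e dvdp_mull.
- by rewrite -(Gauss_dvdpr _ (etrans (coprimep_sym _ _) cab)) e dvdp_mull.
Qed.

Lemma ratdeg_frac (K : fieldType) (a b : {poly K}) :
  b != 0 -> coprimep a b ->
  ratdeg (a%:F / b%:F) = maxn (size a).-1 (size b).-1.
Proof. by move=> b0 c; rewrite /ratdeg; case: (size_ratnum_ratden b0 c) => -> ->. Qed.

Lemma ord_inf_frac (K : fieldType) (a b : {poly K}) :
  b != 0 -> coprimep a b ->
  ord_inf (a%:F / b%:F) = (size b).-1%:Z - (size a).-1%:Z.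
Proof. by move=> b0 c; rewrite /ord_inf; case: (size_ratnum_ratden b0 c) => -> ->. Qed.

(* Main.v *)
(* Write f = g o h over the closed field with g = a/b and h = u/v in lowest
   terms, N = deg g, M = deg h.  The numerator and denominator of f are the
   N-homogenisations of a and b evaluated at (u, v): they have no common zero,
   so deg f = N M.  After a Moebius change of the intermediate variable one may
   assume that h has a pole, of order e <= M, at infinity; then dominant terms
   give ord_inf f = s e with |s| <= N.  As N and M are proper divisors of deg f,
   both |s| and e are at most d < p, so p cannot divide s e <> 0. *)
Require Import Defs.
From HB Require Import structures.
From mathcomp Require Import all_boot all_order all_algebra.
From mathcomp Require Import zify.
Import GRing.Theory.
Local Open Scope ring_scope.

Set Implicit Arguments.
Unset Strict Implicit.

(** If [size a <= N.+1], this is $v^N a(u/v)$ cleared of denominators. The degree [N] is a parameter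
    because both terms of [g] must be homogenised to the same degree, even when their own degrees
    differ. *)
Definition hom_eval {R : comNzRingType} (N : nat) (a : {poly R}) (u v : {poly R}) :
    {poly R} :=
  \sum_(i < N.+1) a`_i *: (u ^+ i * v ^+ (N - i)).

(** For [size a <= N.+1], this is $X^N a(1/X)$: the effect of inverting the intermediate
    variable. *)
Definition rev_poly {R : comNzRingType} (N : nat) (a : {poly R}) : {poly R} :=
  \poly_(i < N.+1) a`_(N - i).

Lemma hom_eval_rev (R : comNzRingType) N (a u v : {poly R}) :
  hom_eval N a u v = hom_eval N (rev_poly N a) v u.
Proof.
rewrite /hom_eval (reindex_inj rev_ord_inj) /=; apply: eq_bigr => i _.
rewrite subSS coef_poly ltn_ord mulrC subKn //.
by rewrite -ltnS.
Qed.

Lemma rev_poly_neq0 (R : comNzRingType) N (a : {poly R}) :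
  (size a <= N.+1)%N -> a != 0 -> rev_poly N a != 0.
Proof.
move=> sa a0; apply/eqP => /polyP /(_ (N - (size a).-1)%N).
have sa0 : (0 < size a)%N by rewrite size_poly_gt0.
rewrite coef_poly coef0 ltnS leq_subr subKn; last by lia.
by move/eqP; rewrite -/(lead_coef a) lead_coef_eq0 (negbTE a0).
Qed.

Lemma size_rev_poly (R : comNzRingType) N (a : {poly R}) :
  a`_0 != 0 -> size (rev_poly N a) = N.+1.
Proof. by move=> a0; rewrite size_poly_eq // subnn. Qed.

Lemma size_mul_exp (R : idomainType) (u v : {poly R}) i j :
  u != 0 -> v != 0 ->
  size (u ^+ i * v ^+ j) = ((size u).-1 * i + (size v).-1 * j).+1.
Proof.
move=> u0 v0; rewrite size_mul ?expf_neq0 // -!size_exp.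
move: (expf_neq0 i u0) (expf_neq0 j v0); rewrite -!size_poly_gt0.
move: (size (u ^+ i)) (size (v ^+ j)) => m n; lia.
Qed.

Lemma predn_maxn (m n : nat) : (maxn m n).-1 = maxn m.-1 n.-1.
Proof. lia. Qed.

(** With [x], [y] the degrees of [u], [v], the left side is the degree of $u^n v^{N-n}$; the right
    side shows that it grows with [n] when [y < x]. *)
Lemma convex_degreeE (N n x y : nat) : (n <= N)%N -> (y <= x)%N ->
  (x * n + y * (N - n) = N * y + n * (x - y))%N.
Proof. by move=> /subnKC <- /subnKC <-; rewrite !addKn; lia. Qed.

(** Since [u] has the larger degree, the degrees of the terms strictly increase with [i], so the
    term of the leading coefficient of [a] cannot be cancelled. *)
Lemma size_hom_eval (R : idomainType) N (a u v : {poly R}) :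
  a != 0 -> (size a <= N.+1)%N -> v != 0 -> (size v < size u)%N ->
  size (hom_eval N a u v)
  = (N * (size v).-1 + (size a).-1 * ((size u).-1 - (size v).-1)).+1.
Proof.
move=> a0 sa v0 vu.
have u0 : u != 0 by rewrite -size_poly_gt0; lia.
have sa0 : (0 < size a)%N by rewrite size_poly_gt0.
have sv0 : (0 < size v)%N by rewrite size_poly_gt0.
have nN : ((size a).-1 <= N)%N by lia.
have dvu : ((size v).-1 < (size u).-1)%N by lia.
have top : size (a`_(size a).-1 *: (u ^+ (size a).-1 * v ^+ (N - (size a).-1)))
    = (N * (size v).-1 + (size a).-1 * ((size u).-1 - (size v).-1)).+1.
  by rewrite size_scale ?lead_coef_eq0 // size_mul_exp // convex_degreeE // ltnW.
have nN1 : ((size a).-1 < N.+1)%N by [].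
rewrite /hom_eval (bigD1 (Ordinal nN1)) //= size_polyDl ?top // ltnS.
apply: leq_trans (size_sum _ _ _) _; apply/bigmax_leqP => i ni.
have [ia|ai] := ltnP i (size a); last first.
  by rewrite nth_default // scale0r size_poly0.
apply: leq_trans (size_scale_leq _ _) _; rewrite size_mul_exp //.
have {}ia : (i < (size a).-1)%N.
  by rewrite ltn_neqAle -ltnS prednK // ia andbT; move: ni; rewrite -val_eqE.
rewrite convex_degreeE ?(ltnW dvu) //; last by rewrite -ltnS.
by rewrite ltn_add2l ltn_mul2r subn_gt0 dvu ia.
Qed.

Lemma hom_monomialE (F : fieldType) N i (c x y : F) : (i < N.+1)%N -> y != 0 ->
  c * (x ^+ i * y ^+ (N - i)) = y ^+ N * (c * (x / y) ^+ i).
Proof.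
rewrite ltnS => iN y0; rewrite [RHS]mulrCA; congr (_ * _).
rewrite expr_div_n mulrCA; congr (_ * _).
by rewrite -{2}(subnK iN) exprD mulfK ?expf_neq0.
Qed.

Lemma frac_hom_eval (L : fieldType) N (a u v : {poly L}) :
  (size a <= N.+1)%N -> v != 0 ->
  (hom_eval N a u v)%:F
  = v%:F ^+ N * (map_poly (fun c : L => c%:P%:F) a).[u%:F / v%:F].
Proof.
move=> sa v0; have vF0 : v%:F != 0 by rewrite tofrac_eq0.
rewrite (@horner_coef_wide _ N.+1); last by apply: leq_trans (size_poly _ _) _.
rewrite mulr_sumr rmorph_sum /=; apply: eq_bigr => i _.
rewrite coef_map_id0 ?polyC0 ?tofrac0 // -mul_polyC !tofracM !tofracXn.
exact: hom_monomialE.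
Qed.

(** In the fraction field, dividing by $v^N$ turns both sides into the value of [a] at $c + w/v$. *)
Lemma hom_eval_shift (L : fieldType) N (a w v : {poly L}) c :
  (size a <= N.+1)%N -> v != 0 ->
  hom_eval N a (c *: v + w) v = hom_eval N (a \Po ('X + c%:P)) w v.
Proof.
move=> sa v0; have vF0 : v%:F != 0 by rewrite tofrac_eq0.
have sac : (size (a \Po ('X + c%:P)) <= N.+1)%N by rewrite size_comp_poly2 ?size_XaddC.
apply/eqP; rewrite -tofrac_eq !frac_hom_eval //; apply/eqP; congr (_ * _).
pose cst := @tofrac {poly L} \o @polyC L.
rewrite -[fun c : L => _]/(cst : L -> _).
rewrite map_comp_poly horner_comp; congr (_.[_]).
rewrite [map_poly _ ('X + _)]rmorphD /= map_polyX map_polyC /= !hornerE.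
by rewrite -mul_polyC tofracD tofracM mulrDl mulfK // addrC.
Qed.

Lemma horner_hom_eval (L : fieldType) N (a u v : {poly L}) z :
  (size a <= N.+1)%N ->
  (hom_eval N a u v).[z] =
  if v.[z] == 0 then a`_N * u.[z] ^+ N else v.[z] ^+ N * a.[u.[z] / v.[z]].
Proof.
move=> sa; rewrite horner_sum; case: eqP => [v0|/eqP v0].
  rewrite (bigD1 ord_max) //= big1 ?addr0 => [|i ni].
    by rewrite subnn mulr1 hornerZ horner_exp.
  rewrite hornerZ hornerM !horner_exp v0 expr0n.
  have -> : (N - i == 0)%N = false.
    by move: ni; rewrite -val_eqE /=; have := ltn_ord i; lia.
  by rewrite !mulr0.
rewrite (horner_coef_wide _ sa) mulr_sumr; apply: eq_bigr => i _.
by rewrite hornerZ hornerM !horner_exp hom_monomialE.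
Qed.

(** A common zero [z] would make $u(z)/v(z)$ a common zero of [a] and [b]; if [v] vanishes at [z],
    this value is infinite and both coefficients of degree [N] would vanish, against the choice of
    [N]. *)
Lemma coprimep_hom_eval (L : closedFieldType) N (a b u v : {poly L}) :
  maxn (size a) (size b) = N.+1 -> coprimep a b -> coprimep u v ->
  coprimep (hom_eval N a u v) (hom_eval N b u v).
Proof.
move=> sab cab cuv; have sa : (size a <= N.+1)%N by lia.
have sb : (size b <= N.+1)%N by lia.
apply/Pdiv.ClosedField.coprimepP => z.
rewrite /root !horner_hom_eval //; have [v0|v0] := eqVneq v.[z] 0.
  have u0 : u.[z] != 0.
    by apply/negP => u0; have := coprimep_root cuv u0; rewrite v0 eqxx.
  rewrite !mulf_eq0 !(negbTE (expf_neq0 _ u0)) !orbF => aN; apply/negP => bN.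
  have [e|e] : size a = N.+1 \/ size b = N.+1 by lia.
    by move: aN; rewrite -[N]/(N.+1.-1) -e -/(lead_coef a) lead_coef_eq0
      -size_poly_eq0 e.
  by move: bN; rewrite -[N]/(N.+1.-1) -e -/(lead_coef b) lead_coef_eq0
    -size_poly_eq0 e.
rewrite !mulf_eq0 !(negbTE (expf_neq0 _ v0)) /= => ra.
exact: coprimep_root cab ra.
Qed.

Lemma hom_eval_degrees_pole (L : fieldType) N (a b u v : {poly L}) :
  a != 0 -> b != 0 -> maxn (size a) (size b) = N.+1 ->
  v != 0 -> (size v < size u)%N ->
  let A := hom_eval N a u v in let B := hom_eval N b u v in
  [/\ B != 0, maxn (size A).-1 (size B).-1 = (N * (size u).-1)%N &
   exists s : int, exists e : nat, [/\ (`|s| <= N)%N, (e <= (size u).-1)%N &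
     (size B).-1%:Z - (size A).-1%:Z = s * e%:Z]].
Proof.
move=> a0 b0 sab v0 vu A B.
have sv0 : (0 < size v)%N by rewrite size_poly_gt0.
have [sa sb] : (size a <= N.+1)%N /\ (size b <= N.+1)%N by lia.
pose deg (n : nat) := (N * (size v).-1 + n.-1 * ((size u).-1 - (size v).-1)).+1.
have sA : size A = deg (size a) := size_hom_eval a0 sa v0 vu.
have sB : size B = deg (size b) := size_hom_eval b0 sb v0 vu.
split; first by rewrite -size_poly_gt0 sB.
  rewrite sA sB /= -addn_maxr -maxnMl.
  by rewrite -predn_maxn sab -mulnDr subnKC // -!subn1 leq_sub2r // ltnW.
(* The order of $a/b$ at infinity, and the order of the pole of $u/v$ there. *)
exists ((size b).-1%:Z - (size a).-1%:Z), ((size u).-1 - (size v).-1)%N.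
split; [lia | lia | rewrite sA sB /=].
by rewrite !PoszD !PoszM opprD addrACA subrr add0r mulrBl.
Qed.

Lemma hom_eval_degrees (L : fieldType) N (a b u v : {poly L}) :
  a != 0 -> b != 0 -> maxn (size a) (size b) = N.+1 -> coprimep a b ->
  v != 0 -> coprimep u v -> (1 < maxn (size u) (size v))%N ->
  let A := hom_eval N a u v in let B := hom_eval N b u v in
  let M := maxn (size u).-1 (size v).-1 in
  [/\ B != 0, maxn (size A).-1 (size B).-1 = (N * M)%N &
   exists s : int, exists e : nat, [/\ (`|s| <= N)%N, (e <= M)%N &
     (size B).-1%:Z - (size A).-1%:Z = s * e%:Z]].
Proof.
move=> a0 b0 sab cab v0 cuv suv A B M.
have [vu|uv] := ltnP (size v) (size u).
  have -> : M = (size u).-1 by rewrite /M; lia.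
  exact: hom_eval_degrees_pole.
have -> : M = (size v).-1 by rewrite /M; lia.
(* Here h(oo) = c is finite, and h = c + w/v; exchange the roles of 0 and oo
   in the intermediate variable h - c. *)
pose c := u`_(size v).-1 / lead_coef v; pose w : {poly L} := u - c *: v.
have wv : (size w < size v)%N.
  have sw : (size w <= size v)%N.
    apply: leq_trans (size_polyD _ _) _; rewrite geq_max uv size_polyN.
    exact: size_scale_leq.
  rewrite ltn_neqAle sw andbT; apply/eqP => e.
  have : lead_coef w == 0.
    by rewrite lead_coefE e coefB coefZ divfK ?lead_coef_eq0 // subrr.
  rewrite lead_coef_eq0 -size_poly_eq0 e; lia.
(* Otherwise [v] divides [u], so by coprimality both are constants, against [suv]. *)
have w0 : w != 0.
  apply/eqP => /subr0_eq uE.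
  have vu : v %| u by rewrite uE -mul_polyC dvdp_mull.
  have /coprimepP/(_ v vu (dvdpp v)) := cuv; rewrite -size_poly_eq1 => /eqP sv1.
  by move: suv; rewrite (maxn_idPr uv) sv1.
pose sh (q : {poly L}) := rev_poly N (q \Po ('X + c%:P)).
have homE (q : {poly L}) : (size q <= N.+1)%N -> hom_eval N q u v = hom_eval N (sh q) v w.
  move=> sq; rewrite -hom_eval_rev -hom_eval_shift //.
  by rewrite addrC subrK.
have sq0 (q : {poly L}) : (size q <= N.+1)%N -> q != 0 -> sh q != 0.
  move=> sq q0; apply: rev_poly_neq0; first by rewrite size_comp_poly2 ?size_XaddC.
  by rewrite -size_poly_gt0 size_comp_poly2 ?size_XaddC // size_poly_gt0.
have shN (q : {poly L}) : q.[c] != 0 -> size (sh q) = N.+1.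
  move=> qc; apply: size_rev_poly.
  by rewrite -horner_coef0 horner_comp !hornerE.
have sh_le (q : {poly L}) : (size (sh q) <= N.+1)%N by apply: size_poly.
(* By coprimality [a] and [b] do not both vanish at [c]; a nonzero value at [c] is the constant
   coefficient after the shift, hence the coefficient of degree [N] after the reversal. *)
have ssh : maxn (size (sh a)) (size (sh b)) = N.+1.
  have := sh_le a; have := sh_le b.
  have [ac|ac] := boolP (root a c).
    by have /shN -> := coprimep_root cab ac; lia.
  by rewrite (shN a) //; lia.
rewrite /A /B !homE; try lia.
by apply: hom_eval_degrees_pole => //; apply: sq0 => //; lia.
Qed.

Lemma comp_rat_hom_eval (L : fieldType) (g h : {fraction {poly L}}) :
  let M := hom_eval (ratdeg g) in
  comp_rat g h = (M (ratnum g) (ratnum h) (ratden h))%:F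
               / (M (ratden g) (ratnum h) (ratden h))%:F.
Proof.
have v0 := ratden_neq0 h.
rewrite /= !frac_hom_eval //; try by rewrite /ratdeg; lia.
by rewrite -ratnumE -mulf_div divff ?mul1r // expf_neq0 // tofrac_eq0.
Qed.

Theorem theorem3p10 (K : fieldType) (Kbar : closedFieldType)
    (iota : {rmorphism K -> Kbar}) (Kbar_closure : algebraic_closure iota)
    (f : {fraction {poly K}}) (f_neq0 : f != 0)
    (d : nat) (d_max : greatest_proper_divisor d (ratdeg f))
    (ord_neq0 : ord_inf f != 0)
    (p : nat) (p_prime : prime p) (d_lt_p : (d < p)%N)
    (p_dvd_ord : (p%:Z %| ord_inf f)%Z) :
  prime_over iota f.
Proof.
case=> g [h [dg dh fE]].
have [v0 b0] := (ratden_neq0 h, ratden_neq0 g).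
have [cuv cab] := (coprimep_ratnum_ratden h, coprimep_ratnum_ratden g).
have sb0 : (0 < size (ratden g))%N by rewrite size_poly_gt0.
have sgE : maxn (size (ratnum g)) (size (ratden g)) = (ratdeg g).+1.
  by rewrite /ratdeg; lia.
have a0 : ratnum g != 0.
  apply/eqP => a0; move: cab dg; rewrite /ratdeg a0 coprime0p -size_poly_eq1.
  by rewrite size_poly0 => /eqP ->.
have suv : (1 < maxn (size (ratnum h)) (size (ratden h)))%N.
  by move: dh; rewrite /ratdeg; lia.
have [B0 degE [s [e [sN eM ordE]]]] := hom_eval_degrees a0 b0 sgE cab v0 cuv suv.
have cAB := coprimep_hom_eval sgE cab cuv.
have den0 : map_poly iota (ratden f) != 0 by rewrite map_poly_eq0 ratden_neq0.
have cf : coprimep (map_poly iota (ratnum f)) (map_poly iota (ratden f)).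
  by rewrite coprimep_map coprimep_ratnum_ratden.
(* The image of [f] and the quotient of the homogenisations are the same fraction, both in lowest
   terms, so their degrees can be compared term by term. *)
have [n1 d1] := size_ratnum_ratden den0 cf.
have [n2 d2] := size_ratnum_ratden B0 cAB.
move: fE; rewrite comp_rat_hom_eval /map_rat => fE.
rewrite fE n2 size_map_poly in n1; rewrite fE d2 size_map_poly in d1.
rewrite n1 d1 -/(ratdeg f) -/(ratdeg h) in degE.
rewrite n1 d1 -/(ord_inf f) -/(ratdeg h) in ordE eM.
have [_ _ _ dmax] := d_max.
(* The divisor is proper because the complementary factor [ratdeg h] is at least 2. *)
have Nd : (ratdeg g <= d)%N.
  by apply: dmax; rewrite ?degE ?dvdn_mulr ?ltn_Pmulr // ltnW.
have Md : (ratdeg h <= d)%N.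
  by apply: dmax; rewrite ?degE ?dvdn_mull ?ltn_Pmull // ltnW.
move: ord_neq0 p_dvd_ord; rewrite ordE mulf_eq0 negb_or => /andP[s0 e0].
rewrite dvdzE abszM /= Euclid_dvdM // => /orP[] /dvdn_leq; lia.
Qed.
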